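(* Let $C_1,\ldots,C_m\subseteq\mathcal{E}$ be closed convex sets with $C:=\bigcap_{i=1}^m C_i\neq\emptyset$. There exists a consistent error bound function $\Phi$ for $C_1,\ldots,C_m$ such that, if $\hat\Phi$ is any other consistent error bound function for $C_1,\ldots,C_m$, then $$\Phi(a,b)\le \hat\Phi(a,b)\qquad \forall\, a,b\in[0,\infty).$$ In particular, $\Phi$ (with this property) is unique.
   Context: $\mathcal{E}$ is a finite-dimensional real vector space with norm $\|\cdot\|$ induced by an inner product, and $\mathrm{dist}(x,D)=\min_{y\in D}\|x-y\|$ for a nonempty closed convex set $D$. A function $\Phi:[0,\infty)\times[0,\infty)\to[0,\infty)$ is a consistent error bound function for $C_1,\ldots,C_m$ if: (i) $\mathrm{dist}(x,C)\le\Phi\big(\max_{1\le i\le m}\mathrm{dist}(x,C_i),\|x\|\big)$ for all $x\in\mathcal{E}$; (ii) for every fixed $b\ge 0$, $\Phi(\cdot,b)$ is monotone nondecreasing on $[0,\infty)$, right-continuous at $0$, and $\Phi(0,b)=0$; (iii) for every fixed $a\ge0$, $\Phi(a,\cdot)$ is monotone nondecreasing on $[0,\infty)$. *)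

(* Defs.v *)
From HB Require Import structures.
From mathcomp Require Import all_boot all_order all_algebra.
From mathcomp Require Import all_classical all_reals all_analysis.
From mathcomp Require Import sesquilinear.

Set Implicit Arguments.
Unset Strict Implicit.
Unset Printing Implicit Defensive.

Import Order.TTheory GRing.Theory Num.Theory.
Import numFieldNormedType.Exports.

Local Open Scope classical_set_scope.
Local Open Scope ring_scope.

#[short(type="normedVectType")]
HB.structure Definition NormedVector (K : numFieldType) :=
  {V of NormedModule K V & Vector K V}.

(* An infimum; by [dist_min] below it is a minimum, as it should be, when [D]
   is closed and nonempty. *)
Definition dist (R : realType) (E : normedVectType R) (x : E) (D : set E) : R :=
  inf [set `|x - y| | y in D].

(* Distances are nonnegative, so for [0 < m] the neutral element 0 does not
   affect the maximum. *)
Definition max_dist (R : realType) (E : normedVectType R) (m : nat)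
    (C : 'I_m -> set E) (x : E) : R :=
  \big[Num.max/0]_(i < m) dist x (C i).

(* A function [0, oo) x [0, oo) -> [0, oo) is represented by a total function
   on R x R of which only the values at nonnegative arguments matter. *)
Definition consistent_error_bound (R : realType) (E : normedVectType R)
    (m : nat) (C : 'I_m -> set E) (Phi : R -> R -> R) : Prop :=
  [/\ forall a b, 0 <= a -> 0 <= b -> 0 <= Phi a b,
      forall x, dist x (\bigcap_i C i) <= Phi (max_dist C x) `|x|,
      forall b, 0 <= b ->
        [/\ forall a a', 0 <= a -> a <= a' -> Phi a b <= Phi a' b,
            Phi a b @[a --> 0^'+] --> Phi 0 b
          & Phi 0 b = 0]
    & forall a, 0 <= a ->
        forall b b', 0 <= b -> b <= b' -> Phi a b <= Phi a b'].

Definition least_consistent_error_bound (R : realType) (E : normedVectType R)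
    (m : nat) (C : 'I_m -> set E) (Phi : R -> R -> R) : Prop :=
  consistent_error_bound C Phi /\
  forall Phi', consistent_error_bound C Phi' ->
    forall a b, 0 <= a -> 0 <= b -> Phi a b <= Phi' a b.

Section DistanceAttained.
Import VectorInternalTheory.
Context {R : realType} {E : normedVectType R}.

Local Notation n := (dim E).

Lemma r2v_continuous : continuous (r2v : 'rV[R]_n -> E).
Proof.
apply: bounded_linear_continuous; apply/linear_boundedP.
exists (\sum_(i < n) `|r2v (delta_mx 0 i) : E|); split => [|r].
  exact: num_real.
move=> rM v; rewrite {1}(row_sum_delta v) linear_sum.
apply: le_trans (ler_norm_sum _ _ _) _.
apply: le_trans (ler_wpM2r (normr_ge0 v) (ltW rM)).
rewrite mulr_suml; apply: ler_sum => i _.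
rewrite linearZ normrZ mulrC ler_wpM2l//.
rewrite /Num.norm/= mx_normrE; exact: (le_bigmax _ (fun p => `|v p.1 p.2|) (0, i)).
Qed.

Lemma r2v_norm_lb : exists2 c : R, 0 < c & forall v : 'rV[R]_n, c * `|v| <= `|r2v v : E|.
Proof.
pose S := [set v : 'rV[R]_n | `|v| = 1].
have cS : compact S.
  apply: bounded_closed_compact.
    by exists 1; split; [exact: num_real|move=> r r1 v /= ->; exact: ltW].
  have -> : S = (fun v : 'rV[R]_n => `|v|) @^-1` [set 1] by [].
  apply: preimage_closed => [v _|]; first exact: norm_continuous.
  exact: closed_eq.
have [S0|S0] := pselect (S !=set0); last first.
  exists 1 => // v; have [->|v0] := eqVneq v 0; first by rewrite normr0 mulr0.
  exfalso; apply: S0; exists (`|v|^-1 *: v).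
  by rewrite /S/= normrZ normfV normr_id mulVf// normr_eq0.
have [|w wS wmin] := @compact_EVT_min _ R (fun v : 'rV[R]_n => `|r2v v : E|) S S0 cS.
  apply: continuous_subspaceT => v.
  by apply: continuous_comp; [exact: r2v_continuous|exact: norm_continuous].
exists `|r2v w : E|.
  rewrite normr_gt0; apply/eqP => rw0.
  have w0 : w = 0 by rewrite -[w]r2vK rw0 linear0.
  by move: wS; rewrite inE /S/= w0 normr0 => /esym/eqP; rewrite oner_eq0.
move=> v; have [->|v0] := eqVneq v 0; first by rewrite normr0 mulr0.
have nv0 : 0 < `|v| by rewrite normr_gt0.
have := wmin (`|v|^-1 *: v); rewrite inE /S/= normrZ normfV normr_id.
rewrite mulVf ?gt_eqF// => /(_ erefl).
by rewrite linearZ normrZ normfV normr_id ler_pdivlMl// mulrC.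
Qed.

Lemma continuous_normB (x : E) : continuous (fun y : E => `|x - y|).
Proof.
move=> y; apply: (@continuous_comp _ _ _ (fun y : E => x - y) Num.norm).
  by apply: continuousB; [exact: cst_continuous|exact: cvg_id].
exact: norm_continuous.
Qed.

Lemma closed_ball_compact (x : E) (r : R) (D : set E) :
  closed D -> compact (D `&` [set y | `|x - y| <= r]).
Proof.
move=> cD; have [c c0 clb] := r2v_norm_lb.
set A := D `&` _.
have cA : closed A.
  apply: closedI => //.
  have -> : [set y : E | `|x - y| <= r] =
      (fun y : E => `|x - y|) @^-1` [set t | t <= r] by [].
  by apply: preimage_closed => [y _|]; [exact: continuous_normB|exact: closed_le].
have -> : A = r2v @` (r2v @^-1` A : set 'rV[R]_n).
  apply/seteqP; split => [y Ay|_ [v Av <-]//].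
  by exists (v2r y); rewrite /= ?v2rK.
apply: continuous_compact.
  by apply: continuous_subspaceT => v; exact: r2v_continuous.
apply: bounded_closed_compact.
  exists (c^-1 * (`|x| + r)); split => [|s xs v /= [_ /= vr]].
    exact: num_real.
  apply: le_trans (ltW xs); rewrite ler_pdivlMl//; apply: le_trans (clb _) _.
  rewrite -[r2v v](subKr x); apply: le_trans (ler_normB _ _) _.
  by rewrite lerD2l.
by apply: preimage_closed => // v _; exact: r2v_continuous.
Qed.

Lemma dist_min (x : E) (D : set E) : closed D -> D !=set0 ->
  exists2 y, D y & dist x D = `|x - y| /\ forall z, D z -> `|x - y| <= `|x - z|.
Proof.
move=> cD [y0 Dy0].
have K0 : (D `&` [set y | `|x - y| <= `|x - y0|]) !=set0 by exists y0; split => /=.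
have [|y] := @compact_EVT_min _ R (fun y : E => `|x - y|) _ K0
  (@closed_ball_compact x `|x - y0| _ cD).
  by apply: continuous_subspaceT => y; exact: continuous_normB.
rewrite inE => -[Dy /= yy0] ymin.
have ymin' z : D z -> `|x - y| <= `|x - z|.
  move=> Dz; have [zy0|/ltW zy0] := leP `|x - z| `|x - y0|.
    by apply: ymin; rewrite inE.
  exact: le_trans zy0.
exists y => //; split => //; apply/eqP; rewrite eq_le; apply/andP; split.
  apply: ge_inf; last by exists y.
  by exists 0 => _ [z _ <-].
by apply: lb_le_inf; [exists `|x - y|, y|move=> _ [z Dz <-]; exact: ymin'].
Qed.

End DistanceAttained.

(* Main.v *)
Require Import Defs.
From mathcomp Require Import all_boot all_order all_algebra.
From mathcomp Require Import all_classical all_reals all_analysis.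
From mathcomp Require Import sesquilinear.

Import Order.TTheory GRing.Theory Num.Theory.
Import numFieldNormedType.Exports.

Local Open Scope classical_set_scope.
Local Open Scope ring_scope.

(** The least consistent error bound function is the worst-case distance
      [Phi a b = sup {dist x C : max_dist x <= a, |x| <= b}].
    It lies below every consistent [Phi'], because monotonicity gives
    [dist x C <= Phi' (max_dist x) |x| <= Phi' a b] for each [x] that competes
    in the supremum. It satisfies the error bound because [x] itself competes
    in [Phi (max_dist x) |x|], and it is monotone because enlarging [a] or [b]
    only adds competitors. Uniqueness is antisymmetry of [<=].

    The analytic content is right-continuity at 0 ([worst_dist_cvg0]). The
    points of the ball of radius [b] at distance at least [e > 0] from [C] form
    a compact set on which the continuous function [max_dist] does not vanish, as its zeros all lie in [C]
    ([max_dist_eq0]); so [max_dist] is at least some [d > 0] there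
    ([max_dist_lb]), and [Phi a b <= e] as soon as [a < d]. *)

Section Distance.
Context {R : realType} {E : normedVectType R}.
Implicit Types (x y : E) (D : set E).

Lemma dist_ge0 x D : 0 <= dist x D.
Proof.
have [->|/set0P D0] := eqVneq D set0; first by rewrite /dist image_set0 inf0.
apply: lb_le_inf; first by case: D0 => y Dy; exists `|x - y|, y.
by move=> _ [y _ <-].
Qed.

Lemma dist_le x {D} y : D y -> dist x D <= `|x - y|.
Proof.
move=> Dy; apply: ge_inf; last by exists y.
by exists 0 => _ [z _ <-].
Qed.

Lemma dist_mem x {D} : D x -> dist x D = 0.
Proof.
move=> Dx; apply/eqP; rewrite eq_le dist_ge0 andbT.
by have := dist_le x x Dx; rewrite subrr normr0.
Qed.

Lemma dist_eq0 x {D} : closed D -> D !=set0 -> dist x D = 0 -> D x.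
Proof.
move=> cD D0; have [y Dy [-> _]] := @dist_min _ _ x D cD D0.
by move=> /eqP; rewrite normr_eq0 subr_eq0 => /eqP ->.
Qed.

Lemma dist_lipschitz {D} x y : D !=set0 -> dist x D <= dist y D + `|x - y|.
Proof.
move=> D0; rewrite -lerBlDr; apply: lb_le_inf.
  by case: D0 => z Dz; exists `|y - z|, z.
move=> _ [z Dz <-]; rewrite lerBlDr addrC.
exact: le_trans (dist_le x z Dz) (ler_distD _ _ _).
Qed.

(** The one-sided Lipschitz estimate suffices, since exchanging [x] and [y]
    gives the other side. *)
Lemma lipschitz1_continuous (f : E -> R) :
  (forall x y, f x <= f y + `|x - y|) -> continuous f.
Proof.
move=> fL x; apply/cvgrPdist_lt => e e0.
near=> y.
have xy : `|x - y| < e by near: y; exact: cvgr_dist_lt.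
apply: le_lt_trans xy; rewrite ler_norml; apply/andP; split.
  by rewrite lerBrDr addrC lerBlDr distrC; exact: fL.
by rewrite lerBlDr addrC; exact: fL.
Unshelve. all: by end_near.
Qed.

Lemma dist_continuous {D} : D !=set0 -> continuous (fun x => dist x D).
Proof.
by move=> D0; apply: lipschitz1_continuous => x y; exact: dist_lipschitz.
Qed.

End Distance.

Section WorstDistance.
Context {R : realType} {E : normedVectType R} {m : nat} (C : 'I_m -> set E).
Implicit Types (x : E) (a b e : R).

Local Notation capC := (\bigcap_i C i).

Lemma max_dist_ge0 x : 0 <= max_dist C x.
Proof. exact: bigmax_ge_id. Qed.

(** The supremum of the empty set is 0, so this is also the right value
    when no point of the ball of radius [b] satisfies [max_dist C x <= a]. *)
Definition worst_dist a b : R :=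
  sup [set dist x capC | x in [set x | max_dist C x <= a /\ `|x| <= b]].

Lemma worst_dist_le a b t : 0 <= t ->
  (forall x, max_dist C x <= a -> `|x| <= b -> dist x capC <= t) ->
  worst_dist a b <= t.
Proof.
move=> t0 h; rewrite /worst_dist; set A := image _ _.
have [->|/set0P A0] := eqVneq A set0; first by rewrite sup0.
by apply: ge_sup => // _ [x [xa xb] <-]; exact: h.
Qed.

Lemma worst_dist_ge0 a b : 0 <= worst_dist a b.
Proof.
rewrite /worst_dist; set A := image _ _.
have [[A0 ubA]|noA] := pselect (has_sup A); last by rewrite sup_out.
case: A0 => t At; apply: le_trans (ub_le_sup ubA At).
by case: At => x _ <-; exact: dist_ge0.
Qed.

Hypothesis capC_neq0 : capC !=set0.

Lemma le_worst_dist a b x :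
  max_dist C x <= a -> `|x| <= b -> dist x capC <= worst_dist a b.
Proof.
move=> xa xb; apply: ub_le_sup; last by exists x.
have [c Cc] := capC_neq0; exists (b + `|c|) => _ [y [_ yb] <-].
apply: le_trans (dist_le y c Cc) _; apply: le_trans (ler_normB _ _) _.
by rewrite lerD2r.
Qed.

Lemma worst_dist_mono a a' b b' :
  a <= a' -> b <= b' -> worst_dist a b <= worst_dist a' b'.
Proof.
move=> aa' bb'; apply: worst_dist_le => [|x xa xb]; first exact: worst_dist_ge0.
by apply: le_worst_dist; [exact: le_trans aa'|exact: le_trans bb'].
Qed.

Let C_neq0 i : C i !=set0.
Proof. by have [c Cc] := capC_neq0; exists c; exact: Cc. Qed.

Lemma max_dist_continuous : continuous (max_dist C).
Proof.
apply: lipschitz1_continuous => x y; apply: bigmax_le => [|i _].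
  by rewrite addr_ge0// max_dist_ge0.
apply: le_trans (dist_lipschitz x y (C_neq0 i)) _.
rewrite lerD2r; exact: (le_bigmax _ (fun i => dist y (C i)) i).
Qed.

Hypothesis C_closed : forall i, closed (C i).

Lemma max_dist_eq0 x : max_dist C x <= 0 -> capC x.
Proof.
move=> x0 i _; apply: dist_eq0 => //; apply/eqP.
rewrite eq_le dist_ge0 andbT; apply: le_trans x0.
exact: (le_bigmax _ (fun i => dist x (C i)) i).
Qed.

(** Compactness of bounded closed sets enters here: without it, points of the
    ball could approach all the [C i] while staying away from their
    intersection. *)
Lemma max_dist_lb b e : 0 < e -> exists2 d, 0 < d &
  forall x, `|x| <= b -> e <= dist x capC -> d <= max_dist C x.
Proof.
move=> e0; pose F : set E := [set x | e <= dist x capC].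
have cF : closed F.
  have -> : F = (fun x => dist x capC) @^-1` [set t | e <= t] by [].
  apply: preimage_closed; last exact: closed_ge.
  by move=> x _; exact: dist_continuous.
pose K := F `&` [set y | `|0 - y| <= b].
have KE x : `|x| <= b -> e <= dist x capC -> K x.
  by move=> xb ex; split => //=; rewrite sub0r normrN.
have [K0|K0] := pselect (K !=set0); last first.
  by exists 1 => // x xb ex; exfalso; apply: K0; exists x; exact: KE.
have [|w] := @compact_EVT_min _ R (max_dist C) K K0
    (@closed_ball_compact _ _ 0 b F cF).
  by apply: continuous_subspaceT; exact: max_dist_continuous.
rewrite inE => -[ew _] wmin; exists (max_dist C w).
  rewrite ltNge; apply/negP => /max_dist_eq0 /dist_mem w0.
  by move: ew; rewrite /F/= w0 leNgt e0.
by move=> x xb ex; apply: wmin; rewrite inE; exact: KE.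
Qed.

Lemma worst_dist0 b : worst_dist 0 b = 0.
Proof.
apply/eqP; rewrite eq_le worst_dist_ge0 andbT.
by apply: worst_dist_le => // x /max_dist_eq0 /dist_mem ->.
Qed.

Lemma worst_dist_cvg0 b : worst_dist a b @[a --> 0^'+] --> (0 : R).
Proof.
apply/cvgrPdist_le => e e0; have [d d0 dlb] := max_dist_lb b e e0.
near=> a.
rewrite sub0r normrN ger0_norm ?worst_dist_ge0//.
apply: worst_dist_le => [|x xa xb]; first exact: ltW.
rewrite leNgt; apply/negP => /ltW ex.
have : a < d by near: a; exact: nbhs_right_lt.
by rewrite ltNge (le_trans (dlb x xb ex) xa).
Unshelve. all: by end_near.
Qed.

Lemma worst_dist_consistent : consistent_error_bound C worst_dist.
Proof.
split.
- by move=> a b _ _; exact: worst_dist_ge0.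
- by move=> x; exact: le_worst_dist.
- move=> b _; split; last exact: worst_dist0.
    by move=> a a' _ aa'; exact: worst_dist_mono.
  by rewrite worst_dist0; exact: worst_dist_cvg0.
- by move=> a _ b b' _ bb'; exact: worst_dist_mono.
Qed.

End WorstDistance.

Lemma worst_dist_least (R : realType) (E : normedVectType R) (m : nat)
    (C : 'I_m -> set E) (Phi : R -> R -> R) (a b : R) :
  consistent_error_bound C Phi -> 0 <= a -> 0 <= b ->
  worst_dist C a b <= Phi a b.
Proof.
move=> [Phi0 Phi_dist Phi_a Phi_b] a0 b0.
apply: worst_dist_le => [|x xa xb]; first exact: Phi0.
apply: le_trans (Phi_dist x) _; have [mono_a _ _] := Phi_a _ (normr_ge0 x).
apply: le_trans (mono_a _ _ (max_dist_ge0 C x) xa) _.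
exact: Phi_b.
Qed.

Theorem proposition3p3 (R : realType) (E : normedVectType R)
    (dot : {dot E for idfun})
    (norm_dot : forall x : E, `|x| = Num.sqrt (dot x x))
    (m : nat) (m_gt0 : (0 < m)%N) (C : 'I_m -> set E)
    (C_closed : forall i, closed (C i))
    (C_convex : forall i, convex_set (C i))
    (C_neq0 : \bigcap_i C i !=set0) :
  exists Phi : R -> R -> R,
    least_consistent_error_bound C Phi /\
    forall Psi : R -> R -> R, least_consistent_error_bound C Psi ->
      forall a b, 0 <= a -> 0 <= b -> Psi a b = Phi a b.
Proof.
have cons := worst_dist_consistent C C_neq0 C_closed.
exists (worst_dist C); split.
  by split => // Phi consPhi a b; exact: worst_dist_least.
move=> Psi [consPsi leastPsi] a b a0 b0; apply/eqP; rewrite eq_le.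
by rewrite leastPsi//= worst_dist_least.
Qed.
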